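(* Let $V$ be a real vector space of dimension $n$, let $S$ be a commutative subsemigroup (or subgroup) of $GL(V)$, let $G$ be the Zariski closure of $S$ in $GL(V)$, and let $T$ be the maximal compact connected subgroup of $G$. If $S$ has a somewhere dense orbit in $V$, then $S$ has at least $n+1-\dim T$ generators.
   Context: A point $x\in V$ has a somewhere dense $S$-orbit if the closure of $S(x)=\{sx:s\in S\}$ contains a non-empty open subset of $V$; $S$ has a somewhere dense orbit if some $x\in V$ does. *)

(* Defs.v *)
From HB Require Import structures.
From mathcomp Require Import all_boot all_order all_algebra.
From mathcomp Require Import all_classical all_reals all_analysis.
Set Implicit Arguments. Unset Strict Implicit. Unset Printing Implicit Defensive.
Import Order.TTheory GRing.Theory Num.Theory.
Import numFieldNormedType.Exports.
Local Open Scope classical_set_scope.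
Local Open Scope ring_scope.

Section Defs.
Variables (R : realType) (n : nat).
Notation M := 'M[R]_n.
Notation V := 'cV[R]_n.

Definition orbit (S : set M) (x : V) : set V := [set s *m x | s in S].

Definition somewhere_dense_orbit (S : set M) (x : V) : Prop :=
  exists U : set V, [/\ open U, U !=set0 & U `<=` closure (orbit S x)].

Definition has_somewhere_dense_orbit (S : set M) : Prop :=
  exists x : V, somewhere_dense_orbit S x.

Definition mul_closed (X : set M) : Prop := forall a b, X a -> X b -> X (a *m b).

Definition GL_subsemigroup (S : set M) : Prop :=
  (forall s, S s -> s \in unitmx) /\ mul_closed S.

Definition GL_subgroup (S : set M) : Prop :=
  [/\ (forall s, S s -> s \in unitmx), S 1%:M, mul_closed S
    & forall s, S s -> S (invmx s)].

Definition commutative_set (S : set M) : Prop :=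
  forall a b, S a -> S b -> a *m b = b *m a.

Definition semigroup_gen (F : seq M) : set M :=
  [set A | forall X : set M, (forall f, f \in F -> X f) -> mul_closed X -> X A].

Definition group_gen (F : seq M) : set M :=
  [set A | forall X : set M, (forall f, f \in F -> X f) -> X 1%:M -> mul_closed X ->
     (forall s, X s -> X (invmx s)) -> X A].

Inductive polyfun : (M -> R) -> Prop :=
| polyfun_cst (c : R) : polyfun (fun _ => c)
| polyfun_coord (i j : 'I_n) : polyfun (fun A => A i j)
| polyfun_add p q : polyfun p -> polyfun q -> polyfun (fun A => p A + q A)
| polyfun_mul p q : polyfun p -> polyfun q -> polyfun (fun A => p A * q A).

(* Zariski closure of S in GL(V): invertible g annihilated by every
   polynomial in the entries vanishing on S (multiplying by powers of det,
   the closed subsets of GL(V) are exactly the traces of such zero sets). *)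
Definition zariski_closure_GL (S : set M) : set M :=
  [set g | g \in unitmx /\
     forall p, polyfun p -> (forall s, S s -> p s = 0) -> p g = 0].

Definition compact_connected_subgroup (G H : set M) : Prop :=
  [/\ H `<=` G, H 1%:M, mul_closed H, (forall s, H s -> H (invmx s))
      & (compact H /\ connected H)].

Definition maximal_compact_connected_subgroup (G T : set M) : Prop :=
  compact_connected_subgroup G T /\
  forall H, compact_connected_subgroup G H -> H `<=` T.

(* tangent space at the identity (= Lie algebra of the closed subgroup H) *)
Definition lie_algebra (H : set M) : set M :=
  [set X | exists c : R -> M, [/\ (forall t, H (c t)), c 0 = 1%:M &
      (forall i j, is_derive (0 : R) (1 : R) (fun t => c t i j) (X i j))]].

Definition subspace_dim (L : set M) (d : nat) : Prop :=
  (exists f : 'I_d -> M, (forall i, L (f i)) /\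
      row_free (\matrix_(i < d) mxvec (f i))) /\
  (forall f : 'I_d.+1 -> M, (forall i, L (f i)) ->
      ~~ row_free (\matrix_(i < d.+1) mxvec (f i))).

Definition lie_dim (T : set M) (d : nat) : Prop := subspace_dim (lie_algebra T) d.

End Defs.

(* Main.v *)
(* Let x be a vector with somewhere dense orbit and C the commutant of S. Then x
   is cyclic, so evaluation at x identifies C with V; C is commutative and its
   units lie in the Zariski closure of S. Let K be the kernel of exp : C -> C^*.
   Every X in K yields a compact connected subgroup exp(R X) of the Zariski
   closure, so X is in the Lie algebra of T, and K spans a space of dimension
   r <= dim T. As exp is open at 0, the logarithms in C of elements of the group
   generated by S are dense near 0. They form a group generated, modulo K, by p
   elements, where p is the number of generators of S. If p + r <= n, some nonzero
   linear form vanishes on K and is integral on these p elements, hence on all the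
   logarithms, contradicting density. *)
Require Import Defs.
From HB Require Import structures.
From mathcomp Require Import all_boot all_order all_algebra.
From mathcomp Require Import all_classical all_reals all_analysis.
From mathcomp Require Import ring lra.
Set Implicit Arguments. Unset Strict Implicit. Unset Printing Implicit Defensive.
Import Order.TTheory GRing.Theory Num.Theory.
Import numFieldNormedType.Exports.
Local Open Scope classical_set_scope.
Local Open Scope ring_scope.

(** * Norms and exponentials of matrices *)

(** Joins completeness to the norm of matrices, so that normally convergent series converge. *)
HB.instance Definition _ (R : realType) m n := Complete.on 'M[R]_(m, n).

Section MatrixNorm.
Context {R : realType}.

Lemma mx_norm_le m n (A : 'M[R]_(m, n)) (c : R) :
  0 <= c -> (forall i j, `|A i j| <= c) -> `|A| <= c.
Proof.
by move=> c0 Ac; rewrite [leLHS]/Num.Def.normr/= mx_normrE; apply: bigmax_le => // -[].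
Qed.

Lemma ler_mx_norm_entry m n (A : 'M[R]_(m, n)) i j : `|A i j| <= `|A|.
Proof.
rewrite [leRHS]/Num.Def.normr/= mx_normrE.
by apply/bigmax_geP; right => /=; exists (i, j).
Qed.

Lemma mx_norm_mulmx m n p (A : 'M[R]_(m, n)) (B : 'M[R]_(n, p)) :
  `|A *m B| <= n%:R * `|A| * `|B|.
Proof.
apply: mx_norm_le => [|i j]; first by rewrite !mulr_ge0.
rewrite mxE (le_trans (ler_norm_sum _ _ _))//.
rewrite (le_trans (ler_sum _ (G := fun=> `|A| * `|B|) _)) => [//|k _|].
  by rewrite normrM ler_pM// ler_mx_norm_entry.
by rewrite sumr_const card_ord -mulrA mulr_natl.
Qed.

Lemma lipschitz_continuous {U V : normedModType R} (f : U -> V) (c : R) :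
  0 <= c -> (forall x y, `|f x - f y| <= c * `|x - y|) -> continuous f.
Proof.
move=> c0 fc x; apply/(@cvgrPdist_lt _ _ _ (nbhs x)) => e e0.
near=> y; apply: le_lt_trans (fc x y) _.
(* The constant [c + 1] is positive even when [c = 0], so it can be divided by. *)
apply: (@le_lt_trans _ _ ((c + 1) * `|x - y|)).
  by rewrite ler_wpM2r// lerDl.
rewrite mulrC -ltr_pdivlMr ?ltr_pwDr//.
by near: y; apply: cvgr_dist_lt => //; rewrite divr_gt0 ?ltr_pwDr.
Unshelve. all: by end_near. Qed.

Lemma continuous_mulmxl m n p (A : 'M[R]_(m, n)) :
  continuous (fun B : 'M[R]_(n, p) => A *m B).
Proof.
apply: (@lipschitz_continuous _ _ _ (n%:R * `|A|)) => [|B B'].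
  by rewrite mulr_ge0.
by rewrite -mulmxBr mx_norm_mulmx.
Qed.

Lemma continuous_mulmxr m n p (B : 'M[R]_(n, p)) :
  continuous (fun A : 'M[R]_(m, n) => A *m B).
Proof.
apply: (@lipschitz_continuous _ _ _ (n%:R * `|B|)) => [|A A'].
  by rewrite mulr_ge0.
by rewrite -mulmxBl (le_trans (mx_norm_mulmx _ _))// mulrAC.
Qed.

Lemma closed_equalizer {U V : normedModType R} (f g : U -> V) :
  continuous f -> continuous g -> closed [set x | f x = g x].
Proof.
move=> cf cg.
have -> : [set x | f x = g x] = (fun x => f x - g x) @^-1` [set 0].
  by apply/seteqP; split=> x /= /eqP; rewrite ?subr_eq0 => /eqP // ->; rewrite subrr.
apply: preimage_closed; first by move=> x _; apply: cvgB; [exact: cf|exact: cg].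
exact/accessible_closed_set1/hausdorff_accessible/norm_hausdorff.
Qed.

Lemma cvg_dist_le {V : normedModType R} (u : V ^nat) (l a : V) (c : R) :
  u @ \oo --> l -> (forall k, `|u k - a| <= c) -> `|l - a| <= c.
Proof.
move=> ul uc; have la : (fun k => `|u k - a|) @ \oo --> `|l - a|.
  by apply: cvg_norm; apply: cvgB => //; exact: cvg_cst.
apply: (closed_cvg (fun y : R => y <= c)) la; first exact: closed_le.
by near=> k; exact: uc.
Unshelve. all: by end_near. Qed.

End MatrixNorm.

(** * Matrix exponential as a normally convergent series *)

Section MatrixExp.
Context {R : realType} {n : nat}.
Local Notation M := 'M[R]_n.+1.
Implicit Types X Y : M.

Lemma mx_norm_mul X Y : `|X * Y| <= n.+1%:R * `|X| * `|Y|.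
Proof. exact: mx_norm_mulmx. Qed.

Lemma mx_norm1 : `|1 : M| <= 1.
Proof.
apply: mx_norm_le => // i j; rewrite mxE.
by case: (_ == _); rewrite ?normr1 ?normr0.
Qed.

Lemma cvg_mulmx {T : Type} {F : set_system T} {FF : Filter F}
    (u v : T -> M) (a b : M) :
  u @ F --> a -> v @ F --> b -> u k * v k @[k --> F] --> a * b.
Proof.
move=> ua vb; have -> : a * b = 0 + a * b + a * b - a * b by rewrite add0r addrK.
(* The terms linear in [u] or [v] converge by one-sided continuity; only the product of the two
   errors needs an estimate. *)
have -> : (fun k => u k * v k) =
    (fun k => (u k - a) * (v k - b) + u k * b + a * v k - a * b).
  apply/funext => k.
  by rewrite mulrBl !mulrBr opprB (addrAC (_ - _)) subrK addrA subrK addrK.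
apply: cvgB; last exact: cvg_cst.
apply: cvgD; last exact: (cvg_comp _ _ vb (@continuous_mulmxl _ _ _ _ a b)).
apply: cvgD; last exact: (cvg_comp _ _ ua (@continuous_mulmxr _ _ _ _ b a)).
apply/cvgr0Pnorm_le => e e0.
have n0 : 0 < n.+1%:R :> R by [].
near=> k; apply: le_trans (mx_norm_mul _ _) _.
have -> : e = n.+1%:R * (e / n.+1%:R) * 1.
  by rewrite mulr1 mulrC divfK// gt_eqF.
rewrite ler_pM ?mulr_ge0//.
  rewrite ler_wpM2l// distrC; near: k.
  by apply: cvgr_dist_le => //; rewrite divr_gt0.
rewrite distrC; near: k.
by apply: cvgr_dist_le.
Unshelve. all: by end_near. Qed.

(** The max norm is submultiplicative only up to the factor [n.+1]; scaled by this factor it becomes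
    submultiplicative. *)
Definition mxsz X : R := n.+1%:R * `|X|.

Lemma mxsz_ge0 X : 0 <= mxsz X. Proof. by rewrite mulr_ge0. Qed.

Lemma mxszM X Y : mxsz (X * Y) <= mxsz X * mxsz Y.
Proof.
by rewrite /mxsz -mulrA ler_wpM2l// mulrCA mulrA mx_norm_mul.
Qed.

(** The left side keeps the max norm, for which the identity has norm at most 1; [mxsz 1] may exceed
    1 and would spoil zero exponents. *)
Lemma mx_norm_expM X Y i j :
  `|X ^+ i * Y ^+ j| <= mxsz X ^+ i * mxsz Y ^+ j.
Proof.
have H Z W k : mxsz (Z ^+ k * W) <= mxsz Z ^+ k * mxsz W.
  elim: k => [|k IH]; first by rewrite !expr0 !mul1r.
  rewrite !exprS -[Z * _ * W]mulrA -[mxsz Z * _ * _]mulrA (le_trans (mxszM _ _))//.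
  by rewrite ler_wpM2l ?mxsz_ge0.
rewrite -(@ler_pM2l _ n.+1%:R)//; have := H X (Y ^+ j) i.
rewrite {1}/mxsz => /le_trans; apply.
rewrite [leRHS]mulrCA ler_wpM2l ?exprn_ge0 ?mxsz_ge0//.
have := H Y 1 j; rewrite mulr1 => /le_trans; apply.
by rewrite mulrC ler_wpM2r ?exprn_ge0 ?mxsz_ge0// ler_piMr// mx_norm1.
Qed.

Definition expmx_coeff X : M ^nat := fun k => (k`!%:R)^-1 *: X ^+ k.

Definition expmx X : M := limn (series (expmx_coeff X)).

Lemma norm_expmx_coeff X k : `|expmx_coeff X k| <= exp_coeff (mxsz X) k.
Proof.
rewrite /expmx_coeff normrZ /exp_coeff/= mulrC ger0_norm ?invr_ge0//.
by rewrite ler_wpM2r ?invr_ge0//; have := mx_norm_expM X 1 k 0;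
  rewrite expr0 !mulr1.
Qed.

Lemma cvg_expmx X : series (expmx_coeff X) @ \oo --> expmx X.
Proof.
apply: normed_cvg; apply: series_le_cvg (is_cvg_series_exp_coeff (mxsz X)).
- by move=> k; exact: normr_ge0.
- by move=> k; rewrite exp_coeff_ge0 ?mxsz_ge0.
- exact: norm_expmx_coeff.
Qed.

Lemma series_exp_coeff_le_expR (x : R) k : 0 <= x -> series (exp_coeff x) k <= expR x.
Proof.
move=> x0; apply: (nondecreasing_cvgn_le _ (is_cvg_series_exp_coeff x)).
by apply/nondecreasing_series => i _ _; exact: exp_coeff_ge0.
Qed.

End MatrixExp.

(** * Products of partial sums of exponential series *)

Section ExpPartialSums.
Context {R : numFieldType} {A : algType R}.
Implicit Types x y : A.

Lemma sum_triangle (F : nat -> nat -> A) N :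
  \sum_(0 <= k < N) \sum_(0 <= i < k.+1) F i (k - i)%N =
  \sum_(0 <= i < N) \sum_(0 <= j < N - i) F i j.
Proof.
elim: N => [|N IH]; first by rewrite !big_geq.
rewrite big_nat_recr//= IH [RHS]big_nat_recr//= subSnn big_nat1.
rewrite [X in _ + X = _]big_nat_recr//= subnn addrA; congr (_ + _).
rewrite -big_split/=; apply: eq_big_nat => i /andP[_ iN].
by rewrite subSn ?(ltnW iN)// [RHS]big_nat_recr.
Qed.

(** By the binomial formula the terms with [i + j < N] form the partial sum at [x + y]; the others
    are the remainder. An arbitrary algebra allows use both for matrices and for the reals that
    bound them. *)
Lemma exp_partial_sumD x y N : GRing.comm x y ->
  (\sum_(0 <= k < N) (k`!%:R : R)^-1 *: x ^+ k) *
  (\sum_(0 <= k < N) (k`!%:R : R)^-1 *: y ^+ k) =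
  \sum_(0 <= k < N) (k`!%:R : R)^-1 *: (x + y) ^+ k +
  \sum_(0 <= i < N) \sum_(N - i <= j < N)
    ((i`!%:R : R)^-1 * (j`!%:R)^-1) *: (x ^+ i * y ^+ j).
Proof.
move=> xy; pose F i j := ((i`!%:R : R)^-1 * (j`!%:R)^-1) *: (x ^+ i * y ^+ j).
have -> : \sum_(0 <= k < N) (k`!%:R : R)^-1 *: (x + y) ^+ k =
    \sum_(0 <= k < N) \sum_(0 <= i < k.+1) F i (k - i)%N.
  apply: eq_bigr => k _; rewrite addrC exprDn_comm; last exact: commr_sym.
  rewrite scaler_sumr big_mkord; apply: eq_bigr => i _.
  have ik : (i <= k)%N by rewrite -ltnS.
  rewrite -scalerMnr scalerMnl /F (commrX _ (commr_sym (commrX _ xy))).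
  congr (_ *: _); rewrite -mulr_natr -(bin_fact ik) !natrM mulrC.
  by rewrite !invfM mulVKf// pnatr_eq0 -lt0n bin_gt0.
rewrite sum_triangle -big_split/= big_distrl/=.
apply: eq_big_nat => i /andP[_ iN]; rewrite -big_cat_nat ?leq_subr//.
rewrite big_distrr/=; apply: eq_bigr => j _.
by rewrite /F -scalerAl -scalerAr scalerA.
Qed.

End ExpPartialSums.

(** * Functional equation and first-order expansion of the exponential *)

Section MatrixExpTheory.
Context {R : realType} {n : nat}.
Local Notation M := 'M[R]_n.+1.
Implicit Types X Y : M.

(** Since [(i + 2)! >= i!], the terms of degree at least 2 are dominated by [mxsz X ^+ 2] times the
    real exponential series. *)
Lemma series_expmx_tail X k :
  `|series (expmx_coeff X) k.+2 - (1 + X)| <= mxsz X ^+ 2 * expR (mxsz X).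
Proof.
rewrite /series/= big_nat_recl//= big_nat_recl//= /expmx_coeff.
rewrite fact0 (_ : 1`! = 1)%N// !invr1 !scale1r expr0 expr1 [1 + (X + _)]addrA.
rewrite (addrC (1 + X)) addrK.
apply: le_trans (ler_norm_sum _ _ _) _.
apply: (@le_trans _ _ (\sum_(0 <= i < k) mxsz X ^+ 2 * exp_coeff (mxsz X) i)).
  apply: ler_sum => i _; apply: le_trans (norm_expmx_coeff _ _) _.
  rewrite /exp_coeff/= -[in X in X / _]add2n exprD -mulrA ler_wpM2l ?sqr_ge0//.
  rewrite ler_wpM2l ?exprn_ge0 ?mxsz_ge0//.
  by rewrite lef_pV2 ?posrE ?ltr0n ?fact_gt0// ler_nat !factS mulnA leq_pmull.
rewrite -big_distrr/= ler_wpM2l ?sqr_ge0//.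
exact: (series_exp_coeff_le_expR _ (mxsz_ge0 _)).
Qed.

Lemma expmx_taylor1 X : `|expmx X - (1 + X)| <= mxsz X ^+ 2 * expR (mxsz X).
Proof.
apply: (@cvg_dist_le _ _ (fun k => series (expmx_coeff X) (k + 2)%N)).
  by rewrite cvg_shiftn; exact: cvg_expmx.
by move=> k; rewrite addn2; exact: series_expmx_tail.
Qed.

(** The remainder [D] is dominated termwise by its analogue [d] for the reals [mxsz X] and [mxsz Y],
    and [d] tends to 0 by the functional equation of [expR]. *)
Lemma expmxD X Y : GRing.comm X Y -> expmx (X + Y) = expmx X * expmx Y.
Proof.
move=> XY.
pose D N := \sum_(0 <= i < N) \sum_(N - i <= j < N)
    ((i`!%:R : R)^-1 * (j`!%:R)^-1) *: (X ^+ i * Y ^+ j).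
pose d N : R := \sum_(0 <= i < N) \sum_(N - i <= j < N)
    ((i`!%:R : R)^-1 * (j`!%:R)^-1) * (mxsz X ^+ i * mxsz Y ^+ j).
have DE N : D N = series (expmx_coeff X) N * series (expmx_coeff Y) N -
    series (expmx_coeff (X + Y)) N.
  by rewrite /series/= exp_partial_sumD// addrC addKr.
have dE N : d N = series (exp_coeff (mxsz X)) N * series (exp_coeff (mxsz Y)) N -
    series (exp_coeff (mxsz X + mxsz Y)) N.
  have := @exp_partial_sumD R R^o (mxsz X) (mxsz Y) N (mulrC _ _).
  have H x : \sum_(0 <= k < N) (k`!%:R : R)^-1 *: (x : R^o) ^+ k = series (exp_coeff x) N.
    by apply: eq_bigr => i _; rewrite /exp_coeff/= mulrC.
  by rewrite !H => ->; rewrite [RHS]addrC addKr.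
have Dd N : `|D N| <= d N.
  apply: le_trans (ler_norm_sum _ _ _) _; apply: ler_sum => i _.
  apply: le_trans (ler_norm_sum _ _ _) _; apply: ler_sum => j _.
  rewrite normrZ ger0_norm ?mulr_ge0 ?invr_ge0//.
  by rewrite ler_wpM2l ?mulr_ge0 ?invr_ge0// mx_norm_expM.
have d0 : d @ \oo --> 0.
  have -> : (0 : R) = expR (mxsz X) * expR (mxsz Y) - expR (mxsz X + mxsz Y).
    by rewrite expRD subrr.
  rewrite (funext dE).
  by apply: cvgB; [apply: cvgM|]; exact: is_cvg_series_exp_coeff.
have D0 : D @ \oo --> 0.
  apply/cvgr0Pnorm_le => e e0; near=> N; apply: le_trans (Dd N) _.
  apply: le_trans (ler_norm _) _; near: N.
  by move/cvgr0Pnorm_le : d0; exact.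
have D1 : D @ \oo --> expmx X * expmx Y - expmx (X + Y).
  rewrite (funext DE).
  by apply: cvgB; [apply: cvg_mulmx|]; exact: cvg_expmx.
apply/esym/eqP; rewrite -subr_eq0; apply/eqP.
exact: (cvg_unique _ D1 D0).
Unshelve. all: by end_near. Qed.

Lemma expmx0 : expmx (0 : M) = 1.
Proof.
have := expmx_taylor1 0; rewrite /mxsz normr0 mulr0 expr0n/= mul0r addr0.
by rewrite normr_le0 subr_eq0 => /eqP.
Qed.

Lemma expmxNK X : expmx (- X) * expmx X = 1.
Proof. by rewrite -expmxD ?addNr ?expmx0// /GRing.comm mulNr mulrN. Qed.

Lemma expmx_unit X : expmx X \is a GRing.unit.
Proof.
apply/unitrP; exists (expmx (- X)); rewrite expmxNK; split=> //.
by rewrite -{1}(opprK X) expmxNK.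
Qed.

Lemma expmxN X : expmx (- X) = (expmx X)^-1.
Proof. by apply: (mulIr (expmx_unit X)); rewrite expmxNK mulVr// expmx_unit. Qed.

Lemma commr_lim X (u : M ^nat) Y :
  (forall k, GRing.comm X (u k)) -> u @ \oo --> Y -> GRing.comm X Y.
Proof.
move=> Xu uY; have c1 : X * u k @[k --> \oo] --> X * Y.
  by apply: cvg_mulmx => //; exact: cvg_cst.
have c2 : u k * X @[k --> \oo] --> Y * X.
  by apply: cvg_mulmx => //; exact: cvg_cst.
by rewrite (funext Xu) in c1; exact: (cvg_unique _ c1 c2).
Qed.

Lemma commr_expmx X Y : GRing.comm X Y -> GRing.comm X (expmx Y).
Proof.
move=> XY; apply: (commr_lim _ (@cvg_expmx _ _ Y)) => k; apply: commr_sum => i _.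
rewrite /expmx_coeff /GRing.comm -scalerAl -scalerAr; congr (_ *: _).
exact: commrX.
Qed.

Lemma expmx_quadratic X : mxsz X <= 1 ->
  `|expmx X - (1 + X)| <= mxsz X ^+ 2 * expR 1.
Proof.
move=> X1; apply: le_trans (expmx_taylor1 X) _.
by rewrite ler_wpM2l ?sqr_ge0// ler_expR.
Qed.

Lemma expmx_near1 X : mxsz X <= 1 -> `|expmx X - 1| <= (1 + expR 1) * mxsz X.
Proof.
move=> X1; rewrite -[expmx X - 1](subrK X).
have -> : expmx X - 1 - X = expmx X - (1 + X) by rewrite opprD addrA.
apply: le_trans (ler_normD _ _) _.
rewrite mulrDl mul1r addrC lerD//.
  by rewrite /mxsz ler_peMl// ler1n.
apply: le_trans (expmx_quadratic X1) _.
by rewrite mulrC ler_wpM2l ?expR_ge0// expr2 ler_piMr ?mxsz_ge0.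
Qed.

(** Commutation gives [exp (u k) = exp Y * exp (u k - Y)], which reduces continuity at [Y] to the
    linear bound near 0. *)
Lemma cvg_expmx_comm {T : Type} {F : set_system T} {FF : Filter F}
    (u : T -> M) Y :
  (forall k, GRing.comm Y (u k)) -> u @ F --> Y ->
  expmx (u k) @[k --> F] --> expmx Y.
Proof.
move=> Yu uY; rewrite -[expmx Y]mulr1.
have e k : expmx (u k) = expmx Y * expmx (u k - Y).
  rewrite -expmxD ?[Y + _]addrC ?subrK//.
  by apply: commrB => //; exact: commr_refl.
rewrite (funext e); apply: cvg_mulmx; first exact: cvg_cst.
apply/cvgrPdist_le => d d0.
have N0 : 0 < n.+1%:R :> R by [].
have E0 : 0 < 1 + expR 1 :> R by rewrite ltr_wpDl// expR_gt0.
near=> k; rewrite distrC.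
have N1 : mxsz (u k - Y) <= 1.
  rewrite /mxsz mulrC -ler_pdivlMr// distrC; near: k.
  by apply: cvgr_dist_le => //; rewrite divr_gt0.
apply: le_trans (expmx_near1 N1) _.
rewrite /mxsz mulrA mulrC -ler_pdivlMr ?mulr_gt0// distrC; near: k.
by apply: cvgr_dist_le => //; rewrite divr_gt0 ?mulr_gt0.
Unshelve. all: by end_near. Qed.

End MatrixExpTheory.

(** * Local surjectivity of the exponential near 1 *)

Section LocalLog.
Context {R : realType} {n : nat}.
Local Notation M := 'M[R]_n.+1.
Implicit Types X Y : M.

Let step X : M := (1 + X) * expmx (- X) - 1.

(** Chosen so that the factor [(N + 2 * N ^+ 2 * E) * |X|] bounding one step, with [N = n.+1] and
    [E = expR 1], is at most 1/2. *)
Let radius : R := (2 * (n.+1%:R + 2 * n.+1%:R ^+ 2 * expR 1))^-1.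

Let radius_gt0 : 0 < radius.
Proof.
rewrite invr_gt0 mulr_gt0// ltr_pwDl// mulr_ge0 ?expR_ge0// mulr_ge0//.
Qed.

(** Exhibits [step X] as a sum of two terms of second order in [X]. *)
Let stepE X : step X = (1 + X) * (expmx (- X) - (1 - X)) - X * X.
Proof.
have e : (1 + X) * (1 - X) = 1 - X * X.
  by rewrite mulrDl mul1r mulrBr mulr1 addrA subrK.
by rewrite /step [in RHS]mulrBr e opprB [in RHS]addrA addrAC addrK.
Qed.

Let norm_step X : `|X| <= radius -> `|step X| <= `|X| / 2.
Proof.
move=> Xr; set N : R := n.+1%:R; set E : R := expR 1.
have N1 : 1 <= N by rewrite ler1n.
have N0 : 0 <= N by [].
have E0 : 0 <= E by exact: expR_ge0.
have c0 : 0 < N + 2 * N ^+ 2 * E.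
  by rewrite ltr_pwDl// mulr_ge0// mulr_ge0// exprn_ge0.
have cX : (N + 2 * N ^+ 2 * E) * `|X| <= 1 / 2.
  rewrite mulrC -ler_pdivlMr//.
  by apply: (le_trans Xr); rewrite /radius -/N -/E invfM mul1r.
have NX : N * `|X| <= 1.
  apply: (@le_trans _ _ (1 / 2)); last by rewrite ler_pdivrMr// mul1r ler1n.
  apply: le_trans cX; rewrite ler_wpM2r// lerDl.
  by rewrite mulr_ge0// mulr_ge0// exprn_ge0.
rewrite stepE; apply: le_trans (ler_normB _ _) _.
have rle : `|expmx (- X) - (1 - X)| <= (N * `|X|) ^+ 2 * E.
  by have := @expmx_quadratic R n (- X); rewrite /mxsz normrN; apply.
have H1 : `|X * X| <= N * `|X| * `|X| by exact: mx_norm_mul.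
have H2 : `|(1 + X) * (expmx (- X) - (1 - X))| <= 2 * ((N * `|X|) ^+ 2 * E).
  rewrite mulrDl mul1r; apply: le_trans (ler_normD _ _) _.
  rewrite mulr_natl mulr2n lerD//; apply: le_trans (mx_norm_mul _ _) _.
  by rewrite -/N -[leRHS]mul1r ler_pM// mulr_ge0.
apply: le_trans (lerD H2 H1) _.
have -> : 2 * ((N * `|X|) ^+ 2 * E) + N * `|X| * `|X| =
  ((N + 2 * N ^+ 2 * E) * `|X|) * `|X| by ring.
by rewrite [leRHS]mulrC ler_wpM2r// -[2^-1]mul1r.
Qed.

(* Multiplicative Newton iteration: [(1 + u) exp(-u) = 1 + u'] with [u']
   quadratically small in [u], so that [1 + u_0 = exp (\sum_k u_k)]. This avoids
   the logarithm series and the inverse function theorem. *)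
Lemma expmx_open (C : set M) :
  C 1 -> (forall X Y, C X -> C Y -> C (X + Y)) -> (forall X, C X -> C (- X)) ->
  (forall X Y, C X -> C Y -> C (X * Y)) -> (forall X, C X -> C (expmx X)) ->
  closed C -> (forall X Y, C X -> C Y -> GRing.comm X Y) ->
  forall e : R, 0 < e -> exists2 d, 0 < d &
    forall a, C a -> `|a - 1| < d -> exists Y, [/\ C Y, `|Y| < e & expmx Y = a].
Proof.
(* Below [radius] every step halves the norm; below [e / 4] the whole sum, at most [2 * |a - 1|],
   stays under [e]. *)
move=> C1 CD CN CM Ce Ccl Cc e e0; exists (Num.min radius (e / 4)).
  by rewrite lt_min radius_gt0/= divr_gt0.
move=> a Ca; rewrite lt_min => /andP[/ltW ar ae].
pose u k := iter k step (a - 1).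
have Cu k : C (u k).
  elim: k => [|k IH]/=; first by apply: CD => //; exact: CN.
  by apply: (CD _ _ _ (CN _ C1)); apply: CM; [exact: CD|apply: Ce; exact: CN].
have uk k : `|u k| <= `|a - 1| * 2^-1 ^+ k.
  elim: k => [|k IH]; first by rewrite expr0 mulr1.
  have kr : `|u k| <= radius.
    apply: (le_trans IH); apply: le_trans ar.
    by rewrite ler_piMr// exprn_ile1// invf_le1// ler1n.
  by rewrite exprSr mulrA (le_trans (norm_step kr))// ler_wpM2r.
have sumu k : \sum_(0 <= i < k) `|u i| <= 2 * `|a - 1|.
  apply: (@le_trans _ _ (\sum_(0 <= i < k) `|a - 1| * 2^-1 ^+ i)).
    by apply: ler_sum => i _; exact: uk.
  have -> : \sum_(0 <= i < k) `|a - 1| * 2^-1 ^+ i =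
      2 * `|a - 1| - 2 * `|a - 1| * 2^-1 ^+ k.
    elim: k => [|k IH]; first by rewrite big_geq// expr0 mulr1 subrr.
    by rewrite big_nat_recr//= IH exprS; field.
  by rewrite gerBl mulr_ge0// ?mulr_ge0// exprn_ge0.
have cu : cvgn (series u).
  apply: normed_cvg; apply: nondecreasing_is_cvgn.
    by apply: nondecreasing_series => i _ _; exact: normr_ge0.
  by exists (2 * `|a - 1|) => _ [k _ <-]; exact: sumu.
have Csu k : C (series u k).
  elim: k => [|k IH]; last by rewrite /series/= big_nat_recr//=; exact: CD.
  by rewrite /series/= big_geq// -(subrr 1); apply: CD => //; exact: CN.
have uY : series u @ \oo --> limn (series u) by exact: cu.
have CY : C (limn (series u)).
  by apply: (closed_cvg C) uY => //; near=> k.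
exists (limn (series u)); split => //.
  apply: (@le_lt_trans _ _ (2 * `|a - 1|)); last first.
    rewrite mulrC -ltr_pdivlMr//; apply: lt_trans ae _.
    by rewrite ltr_pM2l// ltf_pV2 ?posrE// ltr_nat.
  rewrite -[limn _]subr0; apply: (cvg_dist_le uY) => k; rewrite subr0.
  by apply: le_trans (ler_norm_sum _ _ _) _; exact: sumu.
have prodE k : expmx (series u k) * (1 + u k) = a.
  elim: k => [|k <-]; first by rewrite /series/= big_geq// expmx0 mul1r addrC subrK.
  rewrite /series/= big_nat_recr//= expmxD; last exact: (Cc _ _ (Csu k) (Cu k)).
  rewrite -mulrA; congr (_ * _); rewrite addrC subrK.
  have -> : (1 + u k) * expmx (- u k) = expmx (- u k) * (1 + u k).
    by apply: Cc; [exact: CD|apply: Ce; exact: CN].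
  by rewrite mulrA expmxN mulrV ?mul1r// expmx_unit.
have u0 : u @ \oo --> (0 : M) by exact: cvg_series_cvg_0.
have : expmx (series u k) * (1 + u k) @[k --> \oo] -->
    expmx (limn (series u)) * (1 + 0).
  apply: cvg_mulmx; first by apply: cvg_expmx_comm => // k; exact: Cc.
  by apply: cvgD => //; exact: cvg_cst.
rewrite (funext prodE) addr0 mulr1 => h.
exact: (cvg_unique _ h (cvg_cst _)).
Unshelve. all: by end_near. Qed.

End LocalLog.

(** * One-parameter groups and groups of logarithms *)

Section PowersAndCircles.
Context {R : realType} {n : nat}.
Local Notation M := 'M[R]_n.+1.
Implicit Types X Y : M.

Lemma expmxMz X (k : int) : expmx (X *~ k) = expmx X ^ k.
Proof.
have H (m : nat) : expmx (X *+ m) = expmx X ^+ m.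
  elim: m => [|m IH]; first by rewrite mulr0n expmx0.
  rewrite mulrS exprS expmxD ?IH//.
  by apply: commrMn; exact: commr_refl.
case: k => m; first exact: H.
by rewrite NegzE mulrNz expmxN -pmulrn H.
Qed.

Lemma cvg_expmxZ X (t : R) : expmx (s *: X) @[s --> t] --> expmx (t *: X).
Proof.
apply: cvg_expmx_comm => [s|].
  by rewrite /GRing.comm -!scalerAl -!scalerAr !scalerA mulrC.
by apply: cvgZr_tmp; exact: cvg_id.
Qed.

(** The error of the difference quotient is an entry of [(exp (hX) - 1 - hX) / h], which the
    quadratic estimate bounds by a multiple of [|h|]. *)
Lemma derive_expmxZ X i j :
  is_derive (0 : R) (1 : R) (fun t => expmx (t *: X) i j) (X i j).
Proof.
have D : h^-1 *: ((fun t => expmx (t *: X) i j) (h *: (1 : R) + 0) -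
    (fun t => expmx (t *: X) i j) 0) @[h --> (0 : R)^'] --> X i j.
  apply/cvgrPdist_le => e e0.
  have c0 : 0 < mxsz X ^+ 2 * expR 1 + 1.
    by rewrite ltr_pwDr// mulr_ge0 ?expR_ge0// sqr_ge0.
  have N0 : 0 < mxsz X + 1 by rewrite ltr_pwDr// mxsz_ge0.
  near=> h.
  have h0 : h != 0 by near: h; exact: nbhs_dnbhs_neq.
  rewrite distrC /= scale0r expmx0 addr0 /GRing.scale/= mulr1.
  have -> : h^-1 * (expmx (h *: X) i j - (1 : M) i j) - X i j =
      h^-1 * (expmx (h *: X) - (1 + h *: X)) i j.
    by rewrite !mxE; field.
  rewrite normrM normfV ler_pdivrMl ?normr_gt0//.
  apply: le_trans (ler_mx_norm_entry _ _ _) _.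
  have hX : mxsz (h *: X) = `|h| * mxsz X by rewrite /mxsz normrZ mulrCA.
  apply: le_trans (expmx_quadratic _) _.
    rewrite hX; apply: (@le_trans _ _ (`|h| * (mxsz X + 1))).
      by rewrite ler_wpM2l// lerDl.
    rewrite -ler_pdivlMr// mul1r; near: h; apply: dnbhs0_le.
    by rewrite invr_gt0.
  rewrite hX exprMn -[leLHS]mulrA [`|h| ^+ 2]expr2 -[leLHS]mulrA ler_wpM2l//.
  apply: (@le_trans _ _ (`|h| * (mxsz X ^+ 2 * expR 1 + 1))).
    by rewrite ler_wpM2l// lerDl.
  rewrite -ler_pdivlMr//; near: h; apply: dnbhs0_le.
  by rewrite divr_gt0.
apply: DeriveDef; first by apply/cvg_ex; exists (X i j).
exact: cvg_lim D.
Unshelve. all: by end_near. Qed.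

(** When [exp X = 1] the curve [exp (tX)] has period 1, so its range is the image of [[0, 1]]: a
    compact connected subgroup of [G], hence inside [T], with velocity [X] at 0. *)
Lemma circle_lie_algebra (G T : set M) X :
  maximal_compact_connected_subgroup G T ->
  (forall t : R, G (expmx (t *: X))) -> expmx X = 1 -> lie_algebra T X.
Proof.
move=> [_ Tmax] GX X1; pose c t := expmx (t *: X).
have cD s t : c (s + t) = c s * c t.
  rewrite /c scalerDl expmxD// /GRing.comm.
  by rewrite -!scalerAl -!scalerAr !scalerA mulrC.
have cc : continuous c by move=> t; exact: cvg_expmxZ.
have c01 : range c = c @` `[0, 1].
  apply/seteqP; split=> [_ [t _ <-]|_ [t _ <-]]; last by exists t.
  exists (t - (Num.floor t)%:~R).
    by rewrite /= in_itv/= subr_ge0 floor_le/= lerBlDl -intrD1 ltW// floorD1_gt.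
  have cf : c (Num.floor t)%:~R = 1 by rewrite /c scaler_int expmxMz X1 exp1rz.
  by rewrite -[LHS]mulr1 -cf -cD subrK.
exists c; split=> [t| |i j].
- apply: (Tmax (range c)); last by exists t.
  split.
  + by move=> _ [s _ <-]; exact: GX.
  + by exists 0 => //; rewrite /c scale0r expmx0.
  + by move=> _ _ [s _ <-] [s' _ <-]; exists (s + s') => //; exact: cD.
  + move=> _ [s _ <-]; exists (- s) => //.
    by rewrite /c scaleNr expmxN.
  + rewrite c01; split.
      apply: continuous_compact; last exact: segment_compact.
      exact: continuous_subspaceT.
    apply: connected_continuous_connected; first exact: segment_connected.
    exact: continuous_subspaceT.
- by rewrite /c scale0r expmx0.
- exact: derive_expmxZ.
Qed.

End PowersAndCircles.

(** The generator is the least positive element, or 0 if there is none; Euclidean division does the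
    rest. *)
Lemma int_subgroup_principal (J : set int) :
  J 0 -> (forall j k, J j -> J k -> J (j - k)) ->
  exists2 g, J g & forall k, J k -> exists q, k = q * g.
Proof.
move=> J0 JB; pose P (m : nat) := (0 < m)%N && `[< J m%:Z >].
have JN k : J k -> J (- k) by move=> Jk; rewrite -sub0r; exact: JB.
have JD j k : J j -> J k -> J (j + k).
  by move=> Jj Jk; rewrite -(opprK k); apply: JB => //; exact: JN.
have Jabs k : J k -> J `|k|%N%:Z.
  by case: k => // m /JN; rewrite NegzE opprK.
have [[m Pm]|noP] := pselect (exists m, P m); last first.
  exists 0 => // k Jk; exists 0; rewrite mulr0; apply/eqP; rewrite -absz_eq0.
  rewrite -leqn0 leqNgt; apply/negP => k0; apply: noP; exists `|k|%N.
  by rewrite /P k0/=; apply/asboolP; exact: Jabs.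
have exP : exists m, P m by exists m.
case: (ex_minnP exP) => g /andP[g0 /asboolP Jg] gmin; exists g%:Z => // k Jk.
have JM q : J (q * g%:Z).
  suff H (p : nat) : J (p%:Z * g%:Z).
    by case: q => p; rewrite ?NegzE ?mulNr; [|apply: JN]; exact: H.
  by elim: p => [|p IH]; rewrite ?mul0r// -addn1 PoszD mulrDl mul1r; exact: JD.
exists (k %/ g%:Z)%Z; apply/eqP; rewrite -subr_eq0; apply/eqP.
have gz : g%:Z != 0 by rewrite -lt0n.
have Jr : J (k %% g%:Z)%Z by rewrite /modz; exact: JB.
have [r rE] : exists r : nat, (k %% g%:Z)%Z = r.
  by exists `|(k %% g%:Z)%Z|%N; rewrite gez0_abs// modz_ge0.
have rg : (r < g)%N by have := ltz_mod k gz; rewrite rE.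
rewrite -[LHS]/(modz k g%:Z) rE; case: (posnP r) => [->//|r0].
have := gmin r; rewrite /P r0/= -rE => /(_ (asboolT Jr)).
by rewrite leqNgt rg.
Qed.

(** * The commutant, a closed unital subalgebra stable under the exponential *)

Section Commutant.
Context {R : realType} {n : nat}.
Local Notation M := 'M[R]_n.+1.
Variable S : set M.

Definition commutant : set M := [set X | forall s, S s -> GRing.comm s X].

Lemma commutant1 : commutant 1.
Proof. by move=> s _; exact: commr1. Qed.

Lemma commutantD X Y : commutant X -> commutant Y -> commutant (X + Y).
Proof. by move=> CX CY s Ss; apply: commrD; [exact: CX|exact: CY]. Qed.

Lemma commutantN X : commutant X -> commutant (- X).
Proof. by move=> CX s Ss; apply: commrN; exact: CX. Qed.

Lemma commutantB X Y : commutant X -> commutant Y -> commutant (X - Y).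
Proof. by move=> CX CY; apply: commutantD => //; exact: commutantN. Qed.

Lemma commutantZ (a : R) X : commutant X -> commutant (a *: X).
Proof.
by move=> CX s Ss; rewrite /GRing.comm -scalerAl -scalerAr (CX _ Ss).
Qed.

Lemma commutantM X Y : commutant X -> commutant Y -> commutant (X * Y).
Proof. by move=> CX CY s Ss; apply: commrM; [exact: CX|exact: CY]. Qed.

Lemma commutantV X : commutant X -> commutant X^-1.
Proof. by move=> CX s Ss; apply: commrV; exact: CX. Qed.

Lemma commutantMz X (k : int) : commutant X -> commutant (X *~ k).
Proof. by move=> CX s Ss; apply: commrMz; exact: CX. Qed.

Lemma commutantXz X (k : int) : commutant X -> commutant (X ^ k).
Proof. by move=> CX s Ss; apply: commrXz; exact: CX. Qed.

Lemma commutant_expmx X : commutant X -> commutant (expmx X).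
Proof. by move=> CX s Ss; apply: commr_expmx; exact: CX. Qed.

Lemma closed_commutant : closed commutant.
Proof.
rewrite (_ : commutant = \bigcap_(s in S) [set X | s *m X = X *m s])//.
apply: closed_bigI => s _.
by apply: closed_equalizer; [exact: continuous_mulmxl|exact: continuous_mulmxr].
Qed.

End Commutant.

(** * Finitely generated groups of commuting units and their logarithms *)

Section PowerProducts.
Context {R : realType} {n : nat}.
Local Notation M := 'M[R]_n.+1.
Variable S : set M.
Let C := commutant S.
Hypothesis Ccomm : forall X Y, C X -> C Y -> GRing.comm X Y.

(** For commuting units this is the generated group in normal form, with one integer exponent per
    generator, so that induction on [F] peels off one generator at a time. *)
Fixpoint power_products (F : seq M) : set M :=
  if F is f :: F' then
    [set a | exists k : int, exists2 b, power_products F' b & a = f ^ k * b]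
  else [set 1].

Definition units_in (F : seq M) := forall f, f \in F -> C f /\ f \is a GRing.unit.

Lemma units_in_cons f F : units_in (f :: F) ->
  [/\ C f, f \is a GRing.unit & units_in F].
Proof.
move=> uF; have [Cf uf] := uF f (mem_head _ _); split=> // g gF.
by apply: uF; rewrite inE gF orbT.
Qed.

Lemma power_products_units F a :
  units_in F -> power_products F a -> C a /\ a \is a GRing.unit.
Proof.
elim: F a => [a _ ->|f F IH a /units_in_cons[Cf uf uF] [k [b Fb ->]]].
  by split; [exact: commutant1|exact: unitr1].
have [Cb ub] := IH _ uF Fb; split.
  by apply: commutantM => //; exact: commutantXz.
by rewrite unitrMl// unitrXz.
Qed.

Lemma power_products1 F : power_products F 1.
Proof.
by elim: F => //= f F IH; exists 0, 1 => //; rewrite expr0z mulr1.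
Qed.

Lemma power_products_div F a b : units_in F ->
  power_products F a -> power_products F b -> power_products F (a / b).
Proof.
elim: F a b => [a b _ -> ->|f F IH _ _ uF0 [k [a Fa ->]] [l [b Fb ->]]].
  by rewrite divr1.
have [Cf uf uF] := units_in_cons uF0.
have [Cb ub] := power_products_units uF Fb.
have [Ca ua] := power_products_units uF Fa.
exists (k - l), (a / b); first exact: IH.
rewrite exprzDr// -invr_expz invrM ?unitrXz// !mulrA.
have e : GRing.comm (a / b) (f ^ l)^-1.
  by apply: Ccomm; [apply: commutantM => //|]; apply: commutantV => //;
    exact: commutantXz.
by rewrite -!mulrA; congr (_ * _); rewrite !mulrA e mulrA.
Qed.

Lemma power_productsV F a : units_in F ->
  power_products F a -> power_products F a^-1.
Proof.
move=> uF Fa; rewrite -[a^-1]mul1r; apply: power_products_div => //.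
exact: power_products1.
Qed.

Lemma power_productsM F a b : units_in F ->
  power_products F a -> power_products F b -> power_products F (a * b).
Proof.
move=> uF Fa Fb; rewrite -[b]invrK; apply: power_products_div => //.
exact: power_productsV.
Qed.

Lemma power_productsXz F a (k : int) : units_in F ->
  power_products F a -> power_products F (a ^ k).
Proof.
move=> uF Fa; have H (m : nat) : power_products F (a ^+ m).
  elim: m => [|m IH]; first exact: power_products1.
  by rewrite exprS; exact: power_productsM.
case: k => m; first exact: H.
by rewrite NegzE -invr_expz; apply: power_productsV => //; exact: H.
Qed.

Lemma mem_power_products F f : units_in F -> f \in F -> power_products F f.
Proof.
elim: F => // g F IH /units_in_cons[Cg ug uF].
rewrite inE => /orP[/eqP ->|fF].
  by exists 1, 1; [exact: power_products1|rewrite expr1z mulr1].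
by exists 0, f; [exact: IH|rewrite expr0z mul1r].
Qed.

(* The logarithms of elements of the group generated by [F] form, modulo the
   kernel of the exponential, a group generated by the [size F] elements of [Xs];
   this is phrased through its consequence for additive functions [l] that vanish
   on the kernel. The induction uses that the exponents [k] such that [f ^ k * b]
   has a logarithm for some [b] in the group generated by the tail form a subgroup
   of [int]. *)
Lemma log_power_products F : units_in F ->
  exists Xs : seq M, [/\ size Xs = size F, (forall X, X \in Xs -> C X) &
    forall l : {additive M -> R},
      (forall X, X \in Xs -> l X \is a Num.int) ->
      (forall X, C X -> expmx X = 1 -> l X = 0) ->
      forall X, C X -> power_products F (expmx X) -> l X \is a Num.int].
Proof.
elim: F => [_|f F IH uF0].
  by exists [::]; split=> // l _ lK X CX /= X1; rewrite lK// int_num0.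
have [Cf uf uF] := units_in_cons uF0.
have [Xs [sXs CXs lXs]] := IH uF.
pose J k := exists b Y, [/\ power_products F b, C Y & expmx Y = f ^ k * b].
have JB j k : J j -> J k -> J (j - k).
  move=> [a [Y [Fa CY Ya]]] [b [Z [Fb CZ Zb]]].
  have [Cb ub] := power_products_units uF Fb.
  have [Ca ua] := power_products_units uF Fa.
  exists (a / b), (Y - Z); split; first exact: power_products_div.
    exact: commutantB.
  rewrite expmxD ?expmxN; last by apply: Ccomm => //; exact: commutantN.
  rewrite Ya Zb exprzDr// -invr_expz invrM ?unitrXz//.
  have e : GRing.comm (a / b) (f ^ k)^-1.
    by apply: Ccomm; [apply: commutantM => //|]; apply: commutantV => //;
      exact: commutantXz.
  by rewrite -!mulrA; congr (_ * _); rewrite !mulrA e mulrA.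
have J0 : J 0.
  exists 1, 0; split; [exact: power_products1| |].
    by move=> s _; exact: commr0.
  by rewrite expmx0 expr0z mulr1.
have [g [b0 [X0 [Fb0 CX0 X0E]]] gJ] := int_subgroup_principal J0 JB.
have [Cb0 ub0] := power_products_units uF Fb0.
exists (X0 :: Xs); split=> [|X|l lint lK X CX [k [b Fb XE]]].
- by rewrite /= sXs.
- by rewrite inE => /orP[/eqP ->//|]; exact: CXs.
have [q kq] : exists q, k = q * g by apply: gJ; exists b, X.
have [Cb ub] := power_products_units uF Fb.
(* Subtracting [q] copies of [X0] cancels the power of [f], leaving a logarithm of [b / b0 ^ q],
   which the tail generates. *)
have l' : l (X - X0 *~ q) \is a Num.int.
  apply: lXs => //.
  - by move=> Y YXs; apply: lint; rewrite inE YXs orbT.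
  - by apply: commutantB => //; exact: commutantMz.
  rewrite expmxD ?expmxN; last first.
    by apply: Ccomm => //; apply: commutantN; exact: commutantMz.
  rewrite expmxMz X0E XE kq exprMz_comm ?unitrXz//; last first.
    by apply: Ccomm => //; exact: commutantXz.
  rewrite exprz_exp (mulrC g q) invrM ?unitrXz//.
  have e : GRing.comm (b / b0 ^ q) (f ^ (q * g))^-1.
    by apply: Ccomm; [apply: commutantM => //|]; apply: commutantV => //;
      exact: commutantXz.
  rewrite -mulrA [b * (_ * _)]mulrA e mulVKr ?unitrXz//.
  by apply: power_products_div => //; exact: power_productsXz.
rewrite -(subrK (X0 *~ q) X) raddfD/= rpredD// raddfMz rpredMz// lint//.
exact: mem_head.
Qed.

End PowerProducts.

(** * Linear algebra *)

Section FreeFamilies.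
Context {F : fieldType}.

(** The family with [v] put in front of [f] is the block matrix [col_mx v A], whose row space
    strictly contains that of [A]. *)
Lemma row_free_cons m r (f : 'I_r -> 'rV[F]_m) v :
  row_free (\matrix_i f i) -> ~~ (v <= \matrix_i f i)%MS ->
  row_free (\matrix_(i < r.+1) oapp f v (unlift ord0 i)).
Proof.
move=> ff vf; set A := \matrix_i f i in ff vf *.
have e : \matrix_(i < r.+1) oapp f v (unlift ord0 i) = (col_mx v A : 'M[F]_(1 + r, m)).
  apply/matrixP => i j; rewrite mxE; case: unliftP => [k ->|->] /=.
    have -> : lift ord0 k = rshift 1 k by exact: val_inj.
    by apply: etrans (esym (col_mxEd v A k j)); rewrite mxE.
  have -> : (ord0 : 'I_r.+1) = lshift r (ord0 : 'I_1) by exact: val_inj.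
  exact: (esym (col_mxEu v A ord0 j)).
rewrite e -row_leq_rank; move: ff; rewrite -row_leq_rank => /leq_ltn_trans; apply.
have : (A < col_mx v A)%MS.
  by rewrite ltmxE -addsmxE addsmxSr col_mx_sub negb_and vf.
exact: rank_ltmx.
Qed.

(** Take the least [r] such that no [r.+1] members of [P] are free: [r] free members exist, and a
    member outside their span would extend them. *)
Lemma max_free_family m d (P : set 'rV[F]_m) :
  (forall f : 'I_d.+1 -> 'rV_m, (forall i, P (f i)) ->
    ~~ row_free (\matrix_i f i)) ->
  exists2 r, (r <= d)%N & exists2 f : 'I_r -> 'rV_m, (forall i, P (f i)) &
    forall v, P v -> (v <= \matrix_i f i)%MS.
Proof.
move=> Pd; pose Q r := `[< forall f : 'I_r.+1 -> 'rV[F]_m, (forall i, P (f i)) ->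
  ~~ row_free (\matrix_i f i) >].
have exQ : exists r, Q r by exists d; apply/asboolP.
case: (ex_minnP exQ) => r /asboolP Qr rmin; exists r.
  by apply: rmin; apply/asboolP.
have [f Pf ff] : exists2 f : 'I_r -> 'rV[F]_m, (forall i, P (f i)) &
    row_free (\matrix_i f i).
  case: r Qr rmin => [_ _|r _ rmin].
    exists (fun=> 0); first by case.
    by rewrite -row_leq_rank.
  have /asboolPn/existsNP[f /not_implyP[Pf /negP]] : ~~ Q r.
    by apply/negP => /rmin; rewrite ltnn.
  by rewrite negbK => ff; exists f.
exists f => // v Pv; apply: contraT => vf.
suff : ~~ row_free (\matrix_(i < r.+1) oapp f v (unlift ord0 i)).
  by rewrite row_free_cons.
apply: Qr => i.
by case: unliftP => [j _|_] /=; [exact: Pf|].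
Qed.

End FreeFamilies.

(** If the rows of [B] and [A] are jointly free, the values of [c] on them can be prescribed: 1 on
    the first row of [B], which exists as [0 < p], and 0 on the others. Otherwise their rank is
    below [p + r <= n] and a nonzero vector kills them all. *)
Lemma exists_integral_vector (R : realType) (p r n : nat)
    (A : 'M[R]_(r, n)) (B : 'M[R]_(p, n)) :
  (0 < p)%N -> (p + r <= n)%N ->
  exists c : 'cV[R]_n, [/\ c != 0, A *m c = 0 &
    forall j, (B *m c) j 0 \is a Num.int].
Proof.
move=> p0 prn; have [fr|nfr] := boolP (row_free (col_mx B A)).
  have [D DE] := row_freeP fr.
  pose e : 'cV[R]_(p + r) := delta_mx (lshift r (Ordinal p0)) 0.
  have De : col_mx B A *m (D *m e) = e by rewrite mulmxA DE mul1mx.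
  exists (D *m e); split.
  - apply/negP => /eqP c0; move: De; rewrite c0 mulmx0 => /matrixP.
    move=> /(_ (lshift r (Ordinal p0)) 0); rewrite !mxE !eqxx/= => /eqP.
    by rewrite eq_sym oner_eq0.
  - apply/colP => i; have /colP/(_ (rshift p i)) := De.
    rewrite mul_col_mx col_mxEd !mxE => ->.
    by rewrite eq_rlshift.
  - move=> j; have /colP/(_ (lshift r j)) := De.
    rewrite mul_col_mx col_mxEu => ->; rewrite mxE.
    exact: natr_int.
have : kermx (col_mx B A)^T != 0.
  rewrite kermx_eq0 -row_leq_rank mxrank_tr -ltnNge.
  apply: leq_trans prn; rewrite ltn_neqAle rank_leq_row andbT.
  exact: nfr.
case/rowV0Pn => c /sub_kermxP cA c0; exists c^T.
have cc : col_mx B A *m c^T = 0.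
  by apply: trmx_inj; rewrite trmx_mul trmxK cA trmx0.
move: cc; rewrite mul_col_mx => /eqP; rewrite col_mx_eq0 => /andP[/eqP Bc /eqP Ac].
split=> [|//|j]; first by rewrite trmx_eq0.
by rewrite Bc mxE int_num0.
Qed.

(** * The commutant of a commutative semigroup with a somewhere dense orbit *)

Lemma open_line {R : realType} {V : normedModType R} (U : set V) (u v : V) :
  open U -> U u ->
  exists2 d : R, 0 < d & forall t, `|t| < d -> U (u + t *: v).
Proof.
move=> oU Uu; have /nbhs_ballP[d /= d0 dU] : nbhs u U by exact: open_nbhs_nbhs.
have v0 : 0 < `|v| + 1 by rewrite ltr_pwDr.
exists (d / (`|v| + 1)) => [|t td]; first by rewrite divr_gt0.
apply: dU; rewrite -ball_normE /ball_/= opprD addrA subrr add0r normrN normrZ.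
apply: (@le_lt_trans _ _ (`|t| * (`|v| + 1))).
  by rewrite ler_wpM2l// lerDl.
by rewrite -ltr_pdivlMr.
Qed.

(** * Polynomial functions on matrices and their restrictions to lines *)

Section PolynomialFunctions.
Context {R : realType} {n : nat}.
Implicit Types p : 'M[R]_n -> R.

Lemma polyfun_continuous p : polyfun p -> continuous p.
Proof.
elim=> [c|i j|q r _ cq _ cr|q r _ cq _ cr] A.
- exact: (@cst_continuous _ _ c A).
- exact: coord_continuous.
- by apply: continuousD; [exact: cq|exact: cr].
- by apply: continuousM; [exact: cq|exact: cr].
Qed.

Lemma polyfun_line p (A B : 'M[R]_n) : polyfun p ->
  exists P : {poly R}, forall t, p (A + t *: B) = P.[t].
Proof.
elim=> [c|i j|q r _ [P PE] _ [Q QE]|q r _ [P PE] _ [Q QE]].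
- by exists c%:P => t; rewrite hornerC.
- by exists ((A i j)%:P + (B i j) *: 'X) => t; rewrite !hornerE !mxE mulrC.
- by exists (P + Q) => t; rewrite hornerD PE QE.
- by exists (P * Q) => t; rewrite hornerM PE QE.
Qed.

End PolynomialFunctions.

Lemma poly_zero_near0 {R : realType} (P : {poly R}) (d : R) :
  0 < d -> (forall t, `|t| < d -> P.[t] = 0) -> P = 0.
Proof.
move=> d0 Pd; apply/eqP; apply: contraT => P0.
(* The points [d / 2], [d / 3], ... are [size P] distinct roots inside the interval, one more than a
   nonzero [P] can have. *)
pose s := [seq d / (i.+2)%:R | i <- iota 0 (size P)].
have : (size s < size P)%N.
  apply: max_poly_roots => //.
    apply/allP => _ /mapP[i _ ->]; apply/rootP/Pd.
    rewrite ger0_norm ?divr_ge0// ?(ltW d0)// ltr_pdivrMr// ltr_pMr//.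
    by rewrite ltr1n.
  rewrite map_inj_uniq ?iota_uniq// => i j /(mulfI (lt0r_neq0 d0))/invr_inj.
  by move=> /eqP; rewrite eqr_nat => /eqP[].
by rewrite size_map size_iota ltnn.
Qed.

(** * Cyclicity of [x] and its consequences for the commutant *)

Section CyclicVector.
Context {R : realType} {n : nat}.
Local Notation M := 'M[R]_n.+1.
Local Notation V := 'cV[R]_n.+1.
Variables (S : set M) (x : V) (U : set V).
Hypothesis S_comm : forall s t, S s -> S t -> s * t = t * s.
Hypothesis oU : open U.
Hypothesis U0 : U !=set0.
Hypothesis US : U `<=` closure (Defs.orbit S x).
Local Notation C := (commutant S).

(** The orthogonal complement of [c] is closed and contains the orbit, hence contains [U]; moving
    inside [U] in the direction [c] gives [c^T *m c = 0]. *)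
Lemma orbit_spans (c : V) :
  (forall s, S s -> (s *m x)^T *m c = 0) -> c = 0.
Proof.
move=> Sc; have cl : closed [set v : V | c^T *m v = (0 : 'M[R]_1)].
  apply: (@closed_equalizer _ _ _ (fun v : V => c^T *m v) (fun=> 0)).
    exact: continuous_mulmxl.
  exact: cst_continuous.
have Uc v : U v -> c^T *m v = 0.
  move=> /US Sv; apply: cl; apply: closureS Sv => _ [s Ss <-] /=.
  by apply: trmx_inj; rewrite trmx_mul trmxK Sc// trmx0.
have [u Uu] := U0; have [d d0 dU] := open_line c oU Uu.
have /Uc : U (u + (d / 2) *: c).
  by apply: dU; rewrite ger0_norm ?divr_ge0 ?(ltW d0)// ltr_pdivrMr// ltr_pMr// ltr1n.
rewrite mulmxDr Uc// add0r -scalemxAr => /eqP; rewrite scaler_eq0.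
rewrite mulf_eq0 (gt_eqF d0) invr_eq0 pnatr_eq0/= => /eqP/matrixP/(_ 0 0).
rewrite !mxE => /eqP; rewrite psumr_eq0 => [/allP h|i _]; last first.
  by rewrite mxE -expr2 sqr_ge0.
apply/colP => i; have := h i (mem_index_enum _).
by rewrite /= !mxE mulf_eq0 orbb => /eqP.
Qed.

(** Gives a linear right inverse of evaluation at [x]: elements [g i] of [S] are chosen so that the
    vectors [g i *m x] span the space, and [rho v] combines the [g i] with the coordinates of [v].
    Being a combination of elements of [S], it commutes with the commutant. *)
Lemma cyclic_section : exists rho : V -> M, [/\ continuous rho,
  forall v, rho v *m x = v & forall v Z, C Z -> GRing.comm Z (rho v)].
Proof.
pose P := [set v : 'rV[R]_n.+1 | exists2 s, S s & v = (s *m x)^T].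
have [f _|r _ [f Pf fP]] := @max_free_family R n.+1 n.+1 P.
  by rewrite -row_leq_rank -ltnNge ltnS rank_leq_col.
have /choice[g gP] : forall i, exists s, S s /\ f i = (s *m x)^T.
  by move=> i; have [s] := Pf i; exists s.
set A := \matrix_i f i in fP.
have Afull : row_full A.
  rewrite -cokermx_eq0; apply/eqP/matrixP => i j; rewrite [RHS]mxE.
  (* Each column of the cokernel is orthogonal to the rows of [A], hence to the whole orbit. *)
  suff /colP/(_ i) : col j (cokermx A) = 0 by rewrite !mxE.
  apply: orbit_spans => s Ss.
  have /fP/submxP[D ->] : P (s *m x)^T by exists s.
  by rewrite colE mulmxA -(mulmxA D) mulmx_coker mulmx0 mul0mx.
pose co (v : V) i : R := (v^T *m pinvmx A) 0 i.
pose rho (v : V) := \sum_i co v i *: g i.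
have rhox v : rho v *m x = v.
  rewrite mulmx_suml; apply: trmx_inj.
  rewrite -[RHS](mulmxKpV (submx_full _ Afull)) mulmx_sum_row linear_sum/=.
  apply: eq_bigr => i _; rewrite rowK; have [_ ->] := gP i.
  by rewrite -scalemxAl linearZ.
exists rho; split=> //.
  apply: (@lipschitz_continuous _ _ _ _ (\sum_i n.+1%:R * `|pinvmx A| * `|g i|)).
    by apply: sumr_ge0 => i _; rewrite !mulr_ge0.
  move=> v w; rewrite -sumrB mulr_suml.
  apply: le_trans (ler_norm_sum _ _ _) _; apply: ler_sum => i _.
  rewrite -scalerBl normrZ mulrAC ler_wpM2r//.
  have -> : co v i - co w i = ((v - w)^T *m pinvmx A) 0 i.
    by rewrite linearB/= mulmxBl [RHS]mxE [X in _ = _ + X]mxE.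
  apply: le_trans (ler_mx_norm_entry _ _ _) _.
  apply: le_trans (mx_norm_mulmx _ _) _.
  rewrite mulrAC ler_wpM2l ?mulr_ge0//.
  by apply: mx_norm_le => // k j; rewrite mxE ler_mx_norm_entry.
move=> v Z CZ; apply: commr_sum => i _; have [Sgi _] := gP i.
by rewrite /GRing.comm -scalerAl -scalerAr; congr (_ *: _); exact/esym/CZ.
Qed.

(** The difference [X - Y] kills [x] and commutes with each [rho v], so it kills
    [rho v *m x = v]. *)
Lemma commutant_inj X Y : C X -> C Y -> X *m x = Y *m x -> X = Y.
Proof.
move=> CX CY XY; have [rho [_ rhox rhoC]] := cyclic_section.
apply/eqP; rewrite -subr_eq0; apply/eqP/matrixP => i j.
have : (X - Y) *m (rho (delta_mx j 0) *m x) = 0.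
  rewrite mulmxA.
  have -> : (X - Y) *m rho (delta_mx j 0) = rho (delta_mx j 0) *m (X - Y).
    by apply: rhoC; exact: commutantB.
  by rewrite -mulmxA mulmxBl XY subrr mulmx0.
by rewrite rhox -colE => /colP/(_ i); rewrite !mxE.
Qed.

(** As [S] is commutative, [rho] takes values in [C]; injectivity then gives [Y = rho (Y *m x)],
    which commutes with [X]. *)
Lemma commutant_comm X Y : C X -> C Y -> GRing.comm X Y.
Proof.
move=> CX CY; have [rho [_ rhox rhoC]] := cyclic_section.
suff -> : Y = rho (Y *m x) by exact: rhoC.
apply: commutant_inj; rewrite ?rhox//.
by move=> s Ss; apply: rhoC => t St; exact: S_comm.
Qed.

(** If [p] vanishes on [S], then [p \o rho] vanishes on the orbit, since [rho (s *m x) = s], and on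
    [U] by continuity. On the line from [u] in [U] to [g *m x] it is a polynomial in one variable
    vanishing near 0, hence zero at 1, where [rho] takes the value [g]. *)
Lemma commutant_sub_zariski g :
  C g -> g \is a GRing.unit -> zariski_closure_GL S g.
Proof.
move=> Cg ug; split=> // p pp pS.
have [rho [crho rhox rhoC]] := cyclic_section.
have Crho v : C (rho v).
  by move=> s Ss; apply: rhoC => t St; exact: S_comm.
have [u Uu] := U0; have [d d0 dU] := open_line (g *m x - u) oU Uu.
have [P PE] := polyfun_line (rho u) (rho (g *m x - u)) pp.
have rhoD t : rho u + t *: rho (g *m x - u) = rho (u + t *: (g *m x - u)).
  apply: commutant_inj => //; first by apply: commutantD => //; exact: commutantZ.
  by rewrite mulmxDl -scalemxAl !rhox.
have cl : closed [set v | (p \o rho) v = 0 :> R^o].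
  apply: closed_equalizer; last exact: cst_continuous.
  move=> v; apply: continuous_comp; first exact: crho.
  exact: polyfun_continuous.
have pU v : U v -> p (rho v) = 0.
  move=> /US Sv; apply: cl; apply: closureS Sv => _ [s Ss <-] /=.
  have -> : rho (s *m x) = s; last exact: pS.
  by apply: commutant_inj => // t St; exact: S_comm.
have P0 : P = 0.
  by apply: (poly_zero_near0 d0) => t td; rewrite -PE rhoD pU//; exact: dU.
have := PE 1; rewrite P0 horner0 rhoD scale1r addrC subrK => <-.
by congr p; apply: commutant_inj => //; rewrite rhox.
Qed.

End CyclicVector.

(** * Small logarithms from density of the orbit *)

Section SmallLogarithm.
Context {R : realType} {n : nat}.
Local Notation M := 'M[R]_n.+1.
Local Notation V := 'cV[R]_n.+1.
Variables (S : set M) (x : V) (U : set V) (F : seq M).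
Hypothesis S_comm : forall s t, S s -> S t -> s * t = t * s.
Hypothesis oU : open U.
Hypothesis U0 : U !=set0.
Hypothesis US : U `<=` closure (Defs.orbit S x).
Hypothesis uF : units_in S F.
Hypothesis SF : S `<=` power_products F.

(** Let [l X] be the pairing of [X *m x] with [c], and let [l W = 1]. For small [t] the point
    [s0 exp (tW) x] stays in [U]; approximating it by [s *m x] makes [exp (-tW) s0^-1 s] close to 1,
    so equal to [exp Y] with [|l Y| < t]. Then [tW + Y] is a logarithm of [s0^-1 s], and [l] takes
    on it a value in [(0, 2t)]. *)
Lemma exists_small_logarithm (c : V) : c != 0 ->
  exists X, [/\ commutant S X, power_products F (expmx X) &
    0 < ((X *m x)^T *m c) 0 0 < 1].
Proof.
move=> c0; set C := commutant S.
have Ccomm : forall X Y, C X -> C Y -> GRing.comm X Y.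
  exact: (commutant_comm S_comm oU U0 US).
have SC s : S s -> C s by move=> Ss t St; exact: S_comm.
have [rho [crho rhox rhoC]] := cyclic_section oU U0 US.
have Crho v : C (rho v) by move=> s Ss; apply: rhoC; exact: SC.
have rhoE X : C X -> rho (X *m x) = X.
  by move=> CX; exact: (commutant_inj oU U0 US (Crho _) CX (rhox _)).
pose l (X : M) : R := ((X *m x)^T *m c) 0 0.
have lD X Y : l (X + Y) = l X + l Y by rewrite /l mulmxDl linearD/= mulmxDl mxE.
have lZ a X : l (a *: X) = a * l X.
  by rewrite /l -scalemxAl linearZ/= -scalemxAl mxE.
have l_le X : `|l X| <= n.+1%:R * (n.+1%:R * `|X| * `|x|) * `|c|.
  apply: le_trans (ler_mx_norm_entry _ _ _) _.
  apply: le_trans (mx_norm_mulmx _ _) _.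
  rewrite ler_wpM2r// ler_wpM2l//; apply: le_trans (mx_norm_mulmx _ _).
  by apply: mx_norm_le => // i j; rewrite mxE ler_mx_norm_entry.
pose q : R := (c^T *m c) 0 0.
have q0 : 0 < q.
  rewrite lt0r; apply/andP; split; last first.
    by rewrite /q mxE sumr_ge0// => i _; rewrite mxE -expr2 sqr_ge0.
  apply: contra c0; rewrite /q mxE psumr_eq0 => [/allP h|i _]; last first.
    by rewrite mxE -expr2 sqr_ge0.
  apply/eqP/colP => i; have := h i (mem_index_enum _).
  by rewrite /= !mxE mulf_eq0 orbb => /eqP.
pose W := rho (q^-1 *: c).
have CW : C W by exact: Crho.
have lW : l W = 1.
  by rewrite /l rhox linearZ/= -scalemxAl mxE mulVf// gt_eqF.
have [u Uu] := U0; have [_ [[s0 Ss0 <-] Us0]] := US Uu (open_nbhs_nbhs (conj oU Uu)).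
have [t [t0 t1 Ut]] : exists t : R, [/\ 0 < t, t < 1 / 2 &
    U (s0 *m expmx (t *: W) *m x)].
  have ch : continuous (fun y : M => s0 *m y *m x).
    move=> y; apply: (@continuous_comp _ _ _ (mulmx s0) (fun y => y *m x)).
      exact: continuous_mulmxl.
    exact: continuous_mulmxr.
  have := cvg_comp _ _ (@cvg_expmxZ _ _ W 0) (ch _).
  rewrite scale0r expmx0 mulmx1 => /(_ U (open_nbhs_nbhs (conj oU Us0))).
  move=> /nbhs_ballP[d /= d0 dU]; exists (Num.min (d / 2) (1 / 4)); split.
  - by rewrite lt_min !divr_gt0.
  - by rewrite gt_min; apply/orP; right; lra.
  - apply: dU; rewrite -ball_normE /ball_/= sub0r normrN ger0_norm.
      by rewrite gt_min; apply/orP; left; lra.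
    by rewrite le_min !divr_ge0// ltW.
(* [b] bounds the form [l], with 1 added to be positive; [|Y| < t / b] thus forces [|l Y| < t]. *)
pose b := n.+1%:R * (n.+1%:R * `|x|) * `|c| + 1.
have b0 : 0 < b by rewrite ltr_pwDr// !mulr_ge0.
have tb0 : 0 < t / b by rewrite divr_gt0.
have [d d0 dC] := @expmx_open _ _ C (@commutant1 _ _ S) (@commutantD _ _ S)
  (@commutantN _ _ S) (@commutantM _ _ S) (@commutant_expmx _ _ S)
  (@closed_commutant _ _ S) Ccomm _ tb0.
have us s : S s -> s \is a GRing.unit.
  by move=> /SF Fs; have [] := power_products_units uF Fs.
pose g := expmx (- (t *: W)) * s0^-1.
have Cg : C g.
  apply: commutantM; last by apply: commutantV; exact: SC.
  by apply: commutant_expmx; apply: commutantN; exact: commutantZ.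
have phi0 : rho (g *m (s0 *m expmx (t *: W) *m x)) = 1.
  rewrite -[RHS]rhoE; last exact: commutant1.
  congr (rho _); rewrite mulmxA; congr (_ *m _).
  have gE : g * (s0 * expmx (t *: W)) = 1 by rewrite /g -mulrA mulKr ?us// expmxNK.
  exact: gE.
have : nbhs (s0 *m expmx (t *: W) *m x) [set y | `|rho (g *m y) - 1| < d].
  have cphi : continuous (fun y : V => rho (g *m y)).
    move=> y; apply: (@continuous_comp _ _ _ (mulmx g) rho); last exact: crho.
    exact: continuous_mulmxl.
  have /cvgrPdist_lt/(_ _ d0) := cphi (s0 *m expmx (t *: W) *m x).
  by rewrite phi0; apply: filterS => y /=; rewrite distrC.
move=> /(US Ut)[_ [[s Ss <-] /=]]; rewrite mulmxA rhoE; last first.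
  by apply: commutantM => //; exact: SC.
move=> /dC[|Y [CY Yt YE]]; first by apply: commutantM => //; exact: SC.
exists (t *: W + Y); split.
- by apply: commutantD => //; exact: commutantZ.
- rewrite expmxD; last by apply: Ccomm => //; exact: commutantZ.
  rewrite YE /g expmxN -[_ *m s]mulrA mulVKr ?expmx_unit//.
  apply: (power_productsM Ccomm uF _ (SF Ss)).
  exact: (power_productsV Ccomm uF (SF Ss0)).
rewrite -/(l _) lD lZ lW mulr1.
have : `|l Y| < t.
  apply: le_lt_trans (l_le Y) _.
  apply: (@le_lt_trans _ _ (`|Y| * b)); last by rewrite -ltr_pdivlMr.
  rewrite (_ : _ * _ * _ = `|Y| * (n.+1%:R * (n.+1%:R * `|x|) * `|c|)); last by ring.
  by rewrite ler_wpM2l// lerDl.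
rewrite ltr_norml => /andP[h1 h2]; lra.
Qed.

End SmallLogarithm.

(** Serves to exclude an empty list of generators: the orbit would lie in the closed set [{x}],
    which has empty interior in positive dimension. *)
Lemma orbit_not_singleton {R : realType} {n : nat} (S : set 'M[R]_n.+1)
    (x : 'cV[R]_n.+1) (U : set 'cV[R]_n.+1) :
  open U -> U !=set0 -> U `<=` closure (Defs.orbit S x) -> ~ S `<=` [set 1%:M].
Proof.
move=> oU [u Uu] US S1.
have Ux v : U v -> v = x.
  have cl : closed [set y : 'cV[R]_n.+1 | id y = cst x y].
    by apply: closed_equalizer; [move=> y; exact: cvg_id|exact: cst_continuous].
  move=> /US Sv; apply: cl; apply: closureS Sv => _ [s /S1 -> <-] /=.
  by rewrite mul1mx.
have [d d0 dU] := open_line (const_mx 1) oU Uu.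
have /Ux : U (u + (d / 2) *: const_mx 1).
  by apply: dU; rewrite ger0_norm ?divr_ge0 ?(ltW d0)// ltr_pdivrMr// ltr_pMr// ltr1n.
rewrite (Ux _ Uu) -[RHS]addr0 => /addrI/colP/(_ 0); rewrite !mxE mulr1.
by apply/eqP; rewrite mulf_neq0 ?gt_eqF.
Qed.

(** * Counting the generators *)

Theorem theorem5p1 (R : realType) (n : nat) (S : set 'M[R]_n)
  (T : set 'M[R]_n) (dimT : nat) (F : seq 'M[R]_n) :
  (0 < n)%N ->
  commutative_set S ->
  (GL_subsemigroup S /\ S = semigroup_gen F \/ GL_subgroup S /\ S = group_gen F) ->
  maximal_compact_connected_subgroup (zariski_closure_GL S) T ->
  lie_dim T dimT ->
  has_somewhere_dense_orbit S ->
  (n + 1 - dimT <= size F)%N.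
Proof.
case: n S T F => // n S T F _ Scomm genS maxT [_ dimT_max] [x [U [oU U0 US]]].
pose C := commutant S.
have Ccomm : forall X Y, C X -> C Y -> GRing.comm X Y.
  exact: (commutant_comm Scomm oU U0 US).
have SC s : S s -> C s by move=> Ss t St; exact: Scomm.
have uS s : S s -> s \is a GRing.unit by case: genS => [[[]]|[[]]] + + + Ss; auto.
have FS f : f \in F -> S f.
  by move=> fF; case: genS => -[_ ->] Y FY *; exact: FY.
have uF : units_in S F by move=> f /FS Sf; split; [exact: SC|exact: uS].
have SF : S `<=` power_products F.
  have FF f : f \in F -> power_products F f by exact: (mem_power_products uF).
  have FM : mul_closed (power_products F).
    by move=> a b; exact: (power_productsM Ccomm uF).
  case: genS => -[_ ->] s; first exact.
  apply => //; first exact: power_products1.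
  by move=> a; exact: (power_productsV Ccomm uF).
pose P := [set v : 'rV[R]_(n.+1 * n.+1) |
  exists X, [/\ C X, expmx X = 1 & v = mxvec X]].
(* Each [X] in [C] with [exp X = 1] lies in the Lie algebra of [T], so [dimT.+1] of them are never
   free. *)
have [f Pf|r rdim [f Pf fP]] := @max_free_family R _ dimT P.
  have /choice[X XP] : forall i, exists X, [/\ C X, expmx X = 1 & f i = mxvec X].
    by move=> i; exact: Pf.
  have -> : f = fun i => mxvec (X i) by apply/funext => i; have [] := XP i.
  apply: dimT_max => i; have [CX X1 _] := XP i.
  apply: (circle_lie_algebra maxT _ X1) => t.
  apply: (commutant_sub_zariski Scomm oU U0 US); last exact: expmx_unit.
  by apply: commutant_expmx; exact: commutantZ.
rewrite leqNgt; apply/negP; rewrite addn1 => pn.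
(* The dimension is [n.+1] here, and the negated goal reads [dimT + size F < n.+2]. *)
have prn : (size F + r <= n.+1)%N.
  rewrite -ltnS; apply: leq_ltn_trans (leq_add (leqnn _) rdim) _.
  by rewrite addnC -ltn_subRL.
have p0 : (0 < size F)%N.
  case: (F) SF => // S1; case: (orbit_not_singleton oU U0 US).
  exact: S1.
have [Xs [sXs CXs lXs]] := log_power_products Ccomm uF.
(* The rows are the values at [x] of the family spanning the kernel of the exponential ([A]) and of
   the generators of the logarithms ([B]); [c] then defines a form on [C] that vanishes on the
   former and is integral on the latter. *)
pose A := \matrix_(i < r) (vec_mx (f i) *m x)^T.
pose B := \matrix_(j < size F) (Xs`_j *m x)^T.
have [c [c0 Ac Bc]] := exists_integral_vector A B p0 prn.
have [X [CX FX]] := exists_small_logarithm Scomm oU U0 US uF SF c0.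
pose l (Y : 'M[R]_n.+1) : R := ((Y *m x)^T *m c) 0 0.
have ladd : zmod_morphism l.
  by move=> Y Z; rewrite /l mulmxBl linearB/= mulmxBl !mxE.
pose la : {additive 'M[R]_n.+1 -> R} := HB.pack l (GRing.isZmodMorphism.Build _ _ l ladd).
have : l X \is a Num.int.
  apply: (lXs la) => //.
  - move=> Y YXs; have jF : (index Y Xs < size F)%N by rewrite -sXs index_mem.
    have := Bc (Ordinal jF); rewrite /la/= /l.
    by rewrite -[Y in X in _ -> X](nth_index 0 YXs) !mxE; under eq_bigr do rewrite mxE.
  - move=> Y CY Y1; have /fP/submxP[D YD] : P (mxvec Y) by exists Y.
    suff -> : la Y = (D *m (A *m c)) 0 0 by rewrite Ac mulmx0 mxE.
    rewrite /la/= /l mulmxA; congr ((_ *m _) _ _).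
    rewrite mulmx_sum_row -[Y]mxvecK YD mulmx_sum_row linear_sum mulmx_suml linear_sum.
    by apply: eq_bigr => i _; rewrite !rowK !linearZ/= -scalemxAl linearZ.
(* No integer lies strictly between 0 and 1. *)
rewrite -/(l X); case/intrP => k ->; rewrite ltr0z ltrz1.
by case: k => // -[].
Qed.
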